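(* Let $\mu$ and $\nu$ be measures on the measurable space $(\Omega,\Sigma)$. If the pair $(\mu,\nu)$ satisfies the Radon-Nikodym property, then the pair $(\mu,\nu)$ is compatible on $(\Omega,\Sigma)$.
   Context: Measures take values in $[0,+\infty]$, with no finiteness assumption. For a measure $\nu$ put $\mathcal{F}_\nu=\{A\in\Sigma:\nu(A)<+\infty\}$. Radon-Nikodym property: the pair $(\mu,\nu)$ satisfies the Radon-Nikodym property if there exists a measurable function $g:\Omega\to[0,\infty]$ such that $\nu(A)=\int_A g\,d\mu$ for every $A\in\mathcal{F}_\nu$. Compatible: the pair $(\mu,\nu)$ is compatible on $(\Omega,\Sigma)$ if for every $A\in\Sigma$ with $0<\nu(A)<+\infty$ there exists $B\in\Sigma$ with $B\subseteq A$, $0<\nu(B)$ and $0<\mu(B)<+\infty$. *)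

(* Defs.v *)
From HB Require Import structures.
From mathcomp Require Import all_boot all_order all_algebra.
From mathcomp Require Import all_classical all_reals all_analysis.
From mathcomp Require Import measurable_realfun.

Set Implicit Arguments.
Unset Strict Implicit.
Unset Printing Implicit Defensive.

Import Order.TTheory GRing.Theory Num.Theory.

Local Open Scope classical_set_scope.
Local Open Scope ring_scope.
Local Open Scope ereal_scope.

(* A [measurableType] is nonempty by convention (it is pointed); on an empty
   space there is no set of positive measure, so [compatible] is vacuous. *)

Definition finite_measure_sets (d : measure_display) (T : measurableType d)
    (R : realType) (nu : {measure set T -> \bar R}) : set (set T) :=
  [set A | measurable A /\ nu A < +oo].

(* The identity is only required on the sets of finite [nu]-measure. *)
Definition radon_nikodym_property (d : measure_display)
    (T : measurableType d) (R : realType)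
    (mu nu : {measure set T -> \bar R}) : Prop :=
  exists g : T -> \bar R,
    [/\ measurable_fun setT g,
        (forall x, 0 <= g x) &
        forall A, finite_measure_sets nu A -> nu A = \int[mu]_(x in A) g x].

Definition compatible (d : measure_display) (T : measurableType d)
    (R : realType) (mu nu : {measure set T -> \bar R}) : Prop :=
  forall A : set T, measurable A -> 0 < nu A -> nu A < +oo ->
    exists B : set T,
      [/\ measurable B, B `<=` A, 0 < nu B, 0 < mu B & mu B < +oo].

(* Main.v *)
Require Import Defs.
From mathcomp Require Import all_boot all_order all_algebra.
From mathcomp Require Import all_classical all_reals all_analysis.
From mathcomp Require Import measurable_realfun.

(** Let [g] be a density and let [A] satisfy [0 < nu A < +oo].  Since the
    integral of [g] over [A] is positive, [g] is bounded below by some constant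
    [e > 0] on a subset [B] of [A] with [0 < mu B]
    ([integral_gt0_superlevel_measure_gt0]).
    As [nu B <= nu A < +oo], the density formula also holds on
    [B], and bounding [g] below by [e] there ([ge0_mule_le_integral]) gives
    [e * mu B <= nu B].  This one inequality settles both remaining
    conditions on [B]: read from the left, [0 < mu B] forces [0 < nu B]; read
    from the right, [nu B < +oo] forces [mu B < +oo]. *)

Local Open Scope classical_set_scope.
Local Open Scope ring_scope.

Import Order.TTheory GRing.Theory Num.Theory.

Lemma ge0_mule_le_integral (d : measure_display) (T : measurableType d)
    (R : realType) (mu : {measure set T -> \bar R}) (D : set T)
    (f : T -> \bar R) (e : R) :
  measurable D -> measurable_fun D f -> 0 <= e ->
  (forall x, D x -> (e%:E <= f x)%E) ->
  (e%:E * mu D <= \int[mu]_(x in D) f x)%E.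
Proof.
move=> mD mf e0 ef; rewrite -integral_cst//.
by apply: ge0_le_integral => // x Dx /=; rewrite lee_fin.
Qed.

(** Otherwise all the sets [D `&` [set x | n.+1%:R^-1%:E <= f x]] are null.
    Their union contains every point of [D] where [f] is positive, so [f]
    vanishes almost everywhere on [D] and its integral is zero. *)
Lemma integral_gt0_superlevel_measure_gt0 (d : measure_display)
    (T : measurableType d) (R : realType) (mu : {measure set T -> \bar R})
    (D : set T) (f : T -> \bar R) :
  measurable D -> measurable_fun D f -> (forall x, D x -> (0 <= f x)%E) ->
  (0 < \int[mu]_(x in D) f x)%E ->
  exists2 e : R, 0 < e & (0 < mu (D `&` [set x | e%:E <= f x]))%E.
Proof.
move=> mD mf f0 intf; apply: contrapT => noe.
pose B n := D `&` [set x | n.+1%:R^-1%:E <= f x]%E.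
have Bnull n : mu.-negligible (B n).
  apply/negligibleP; first exact: emeasurable_fun_c_infty.
  apply/eqP; rewrite -measure_le0 leNgt; apply/negP => muB.
  by apply: noe; exists n.+1%:R^-1.
have f_ae0 : ae_eq mu D f (cst 0%E).
  apply: negligibleS (negligible_bigcup Bnull) => x /= /not_implyP[Dx fx0].
  have {fx0} : (0 < f x)%E by rewrite lt0e f0// andbT; apply/eqP.
  case fxE : (f x) => [r| |] //; last first.
    by exists 0%N => //; split => //=; rewrite fxE leey.
  rewrite lte_fin => /ltr_add_invr[n]; rewrite add0r => /ltW nr.
  by exists n => //; split => //=; rewrite fxE lee_fin.
move: intf; rewrite (ge0_ae_eq_integral mD mf _ f0 _ f_ae0)//.
by rewrite integral0 ltxx.
Qed.

Theorem theorem3p1 (d : measure_display) (T : measurableType d)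
    (R : realType) (mu nu : {measure set T -> \bar R}) :
  radon_nikodym_property mu nu -> compatible mu nu.
Proof.
move=> [g [mg g0 nuE]] A mA nuA0 nuAoo.
have mgS D : measurable_fun D g by exact: measurable_funS mg.
have [e e0 muB0] : exists2 e : R,
    0 < e & (0 < mu (A `&` [set x | e%:E <= g x]))%E.
  by apply: integral_gt0_superlevel_measure_gt0 => //; rewrite -nuE.
set B := A `&` _ in muB0.
have mB : measurable B by exact: emeasurable_fun_c_infty.
have BA : B `<=` A by exact: subIsetl.
have nuBoo : (nu B < +oo)%E.
  by apply: le_lt_trans nuAoo; apply: le_measure; rewrite ?inE.
have e_muB_le : (e%:E * mu B <= nu B)%E.
  by rewrite nuE//; apply: ge0_mule_le_integral => //; [exact: ltW | move=> x []].
exists B; split=> //.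
  by apply: lt_le_trans e_muB_le; rewrite mule_gt0 ?lte_fin.
(* An infinite [mu B] would make the left-hand side [e * mu B] infinite. *)
rewrite ltey; apply/eqP => muBoo.
by move: (le_lt_trans e_muB_le nuBoo); rewrite muBoo gt0_muley ?lte_fin ?ltxx.
Qed.
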